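(* For all integers $1\le k<n$ there exists a constant $\lambda_{nk}>1$ with the following property. Let $X_1,\dots,X_n$ be Polish spaces, let $\{\mu_\alpha\}_{\alpha\in\mathcal{I}_{nk}}$ be a consistent family of probability measures $\mu_\alpha\in\mathcal{P}(X_\alpha)$, and let $\nu_i\in\mathcal{P}(X_i)$, $1\le i\le n$. Suppose each $\mu_\alpha$ is absolutely continuous with respect to $\nu_\alpha=\prod_{i\in\alpha}\nu_i$, $\mu_\alpha=\rho_\alpha\cdot\nu_\alpha$, and that there are constants $0<m\le M$ with $m\le\rho_\alpha\le M$ $\nu_\alpha$-almost everywhere for all $\alpha\in\mathcal{I}_{nk}$. If $M/m\le\lambda_{nk}$, then $\Pi(\mu_\alpha)$ is nonempty.
   Context: $X=\prod_{i=1}^nX_i$; $\mathcal{I}_{nk}$ is the family of $k$-element subsets of $\{1,\dots,n\}$; $X_\alpha=\prod_{i\in\alpha}X_i$; $\mathrm{Pr}_\alpha$ is the coordinate projection onto $X_\alpha$. A family $\{\mu_\alpha\}_{\alpha\in\mathcal{I}_{nk}}$ is consistent if $\mathrm{Pr}_{\alpha\cap\beta}(\mu_\alpha)=\mathrm{Pr}_{\alpha\cap\beta}(\mu_\beta)$ for all $\alpha,\beta\in\mathcal{I}_{nk}$. $\Pi(\mu_\alpha)$ denotes the set of (nonnegative) probability measures $\mu$ on $X$ with $\mathrm{Pr}_\alpha(\mu)=\mu_\alpha$ for all $\alpha\in\mathcal{I}_{nk}$ (uniting measures). *)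

(* Defs.v *)
From HB Require Import structures.
From mathcomp Require Import all_boot all_order all_algebra.
From mathcomp Require Import all_classical all_reals all_analysis.
Unset Printing Implicit Defensive.
Import Order.TTheory GRing.Theory Num.Theory.
Local Open Scope classical_set_scope.
Local Open Scope ring_scope.

Definition is_metric {R : realType} {T : Type} (d : T -> T -> R) : Prop :=
  [/\ forall x y, 0 <= d x y,
      forall x y, d x y = 0 <-> x = y,
      forall x y, d x y = d y x &
      forall x y z, d x z <= d x y + d y z].

Definition metric_induces_topology {R : realType} {T : topologicalType}
  (d : T -> T -> R) : Prop :=
  forall A : set T, open A <->
    (forall x, A x -> exists2 e : R, 0 < e & [set y | d x y < e] `<=` A).

Definition metric_complete {R : realType} {T : Type} (d : T -> T -> R) : Prop :=
  forall u : nat -> T,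
    (forall e : R, 0 < e -> exists N, forall p q, (N <= p)%N -> (N <= q)%N ->
        d (u p) (u q) < e) ->
    exists x, forall e : R, 0 < e -> exists N, forall p, (N <= p)%N ->
        d (u p) x < e.

Definition polish (R : realType) (T : topologicalType) : Prop :=
  (exists D : set T, countable D /\ closure D = setT) /\
  (exists d : T -> T -> R,
      [/\ is_metric d, metric_induces_topology d & metric_complete d]).

Definition Borel (T : ptopologicalType) := g_sigma_algebraType (@open T).

Section Products.
Variables (n : nat) (X : 'I_n -> ptopologicalType).

Definition Xraw (A : {set 'I_n}) := forall i : {i : 'I_n | i \in A}, X (val i).

Definition cylA (A : {set 'I_n}) : set (set (Xraw A)) :=
  [set C | exists i : {i : 'I_n | i \in A}, exists2 B : set (Borel (X (val i))),
     measurable B & C = [set f | B (f i)]].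

Definition Xs (A : {set 'I_n}) := g_sigma_algebraType (cylA A).

Definition Xfullraw := forall i : 'I_n, X i.
Definition cylF : set (set Xfullraw) :=
  [set C | exists i : 'I_n, exists2 B : set (Borel (X i)),
     measurable B & C = [set f | B (f i)]].
Definition Xfull := g_sigma_algebraType cylF.

Definition Pr (A : {set 'I_n}) : Xfull -> Xs A := fun f i => f (val i).

Definition restr (A B : {set 'I_n}) (h : B \subset A) : Xs A -> Xs B :=
  fun f j => f (exist (fun i => i \in A) (val j) (fintype.subsetP h _ (valP j))).

End Products.
Arguments Xraw {n} X A.
Arguments cylA {n} X A.
Arguments Xs {n} X A.
Arguments Xfullraw {n} X.
Arguments cylF {n} X.
Arguments Xfull {n} X.
Arguments Pr {n X} A.
Arguments restr {n X A B} h.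

Definition consistent {R : realType} {n : nat} (k : nat) {X : 'I_n -> ptopologicalType}
  (mu : forall A : {set 'I_n}, probability (Xs X A) R) : Prop :=
  forall a b : {set 'I_n}, #|a| = k -> #|b| = k ->
    forall E : set (Xs X (a :&: b)), measurable E ->
      mu a (restr (subsetIl a b) @^-1` E) = mu b (restr (subsetIr a b) @^-1` E).

Definition is_product_measure {R : realType} {n : nat}
  {X : 'I_n -> ptopologicalType} (A : {set 'I_n})
  (nu : forall i : 'I_n, probability (Borel (X i)) R)
  (nuA : probability (Xs X A) R) : Prop :=
  forall B : forall i : {i : 'I_n | i \in A}, set (Borel (X (val i))),
    (forall i, measurable (B i)) ->
    nuA [set f : Xs X A | forall i, B i (f i)]
      = (\prod_(i : {i : 'I_n | i \in A}) fine (nu (val i) (B i)))%:E.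

Definition has_density {R : realType} {d : measure_display} {T : measurableType d}
  (mu nu : probability T R) (rho : T -> R) : Prop :=
  measurable_fun setT rho /\
  forall E : set T, measurable E -> mu E = (\int[nu]_(x in E) (rho x)%:E)%E.

Definition uniting {R : realType} {n : nat} (k : nat) {X : 'I_n -> ptopologicalType}
  (mu : forall A : {set 'I_n}, probability (Xs X A) R)
  (P : probability (Xfull X) R) : Prop :=
  forall a : {set 'I_n}, #|a| = k ->
    forall E : set (Xs X a), measurable E -> P (Pr a @^-1` E) = mu a E.

(* Main.v *)
(** Let Q be the product of the nu_i on X.  Starting from P = Q, treat the k-subsets a
   one after the other, replacing P by
     P + (mu_a x nu_{a^c}) - (Pr_a P x nu_{a^c}).
   This corrects the a-marginal, and it does not change the marginals on the
   subsets b already treated: the b-marginal of (sigma x nu_{a^c}) depends only on the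
   marginal of sigma on the intersection of a and b, which by consistency is the same
   for mu_a and for Pr_a P.  If (1 - e) Q <= P <= (1 + e) Q and mu_a is within a factor
   1 +- eps of nu_a, the new measure is within 1 +- (2 e + eps) of Q; hence after N
   steps the deviation is at most (2^N - 1) eps, and positivity is preserved
   throughout once eps = 2^-N, where N is the number of k-subsets. *)
Require Import Defs.
From HB Require Import structures.
From mathcomp Require Import all_boot all_order all_algebra.
From mathcomp Require Import all_classical all_reals all_analysis.
From mathcomp Require Import measurable_realfun ring lra.
Import Order.TTheory GRing.Theory Num.Theory.
Local Open Scope classical_set_scope.
Local Open Scope ring_scope.

(** * Images, differences and products of probability measures *)

Definition pushP {d d' : measure_display} {T : measurableType d}
    {T' : measurableType d'} {R : realType} (P : probability T R) (f : T -> T')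
    (mf : measurable_fun setT f) : probability T' R :=
  distribution P (mfun_Sub (mem_set mf)).
Arguments pushP {d d' T T' R} P {f} mf.

Lemma pushPE {d d' : measure_display} {T : measurableType d}
    {T' : measurableType d'} {R : realType} (P : probability T R) (f : T -> T')
    (mf : measurable_fun setT f) (E : set T') :
  pushP P mf E = P (f @^-1` E).
Proof. by []. Qed.

(* [measure_of_charge] wants nonnegativity on all sets, hence the restriction
   [crestr0], which sends nonmeasurable sets to 0. *)
Lemma probability_addsub {d : measure_display} {T : measurableType d}
    {R : realType} (P Q K : probability T R) :
  (forall E, measurable E -> (K E <= P E + Q E)%E) ->
  exists P' : probability T R,
    forall E, measurable E -> (P' E = P E + Q E - K E)%E.
Proof.
move=> KPQ.
pose c : {charge set T -> \bar R} :=
  cadd (cadd (charge_of_finite_measure P) (charge_of_finite_measure Q))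
       (cscale (-1) (charge_of_finite_measure K)).
have cE E : c E = (P E + Q E - K E)%E.
  by rewrite -[LHS]/(P E + Q E + cscale (-1) (charge_of_finite_measure K) E)%E cscaleN1.
have c0 : forall E, measurable E -> (0 <= c E)%E.
  move=> E mE; rewrite cE sube_ge0 ?KPQ//.
  by rewrite fin_num_measure.
have ctotal : forall E : set T, (0 <= crestr0 c measurableT E)%E.
  move=> E; rewrite /crestr0/=; case: ifPn => // /[!inE] mE.
  by rewrite /crestr setIT c0.
pose mc := measure_of_charge (crestr0 c measurableT) ctotal.
have mcE E : measurable E -> mc E = (P E + Q E - K E)%E.
  move=> mE; rewrite /mc /measure_of_charge /crestr0 mem_set//=.
  by rewrite /crestr setIT -cE.
(* The total mass is 1 + 1 - 1. *)
have mc1 : mc setT = 1%E.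
  by rewrite mcE// !probability_setT addeK.
pose mcP := Measure_isProbability.Build _ _ _ mc mc1.
pose p : probability T R := HB.pack mc mcP.
by exists p.
Qed.

(** By construction [\x] integrates x-sections over the first factor. Integrating y-sections over
    the second gives the same values on rectangles, hence the same measure. This form keeps [P]
    inside the integrand, where it can be compared with another measure. *)
Lemma product_measure1_ysection {d d' : measure_display} {T : measurableType d}
    {T' : measurableType d'} {R : realType} (P : probability T R)
    (Q : probability T' R) (A : set (T * T')) : measurable A ->
  ((P \x Q) A = \int[Q]_y P (ysection A y))%E.
Proof.
move=> mA; rewrite [RHS](_ : _ = (P \x^ Q)%E A)//.
apply: product_measure_unique => //= B C mB mC.
by rewrite product_measure2E.
Qed.

(** The inequality holds section by section and is then integrated against [Q]. With a constant on
    each side, one statement serves for lower and upper bounds. *)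
Lemma le_product_measure1 {d d' : measure_display} {T : measurableType d}
    {T' : measurableType d'} {R : realType} (P P' : probability T R)
    (Q : probability T' R) (c c' : R) : 0 <= c -> 0 <= c' ->
  (forall E, measurable E -> (c%:E * P E <= c'%:E * P' E)%E) ->
  forall A, measurable A -> (c%:E * (P \x Q) A <= c'%:E * (P' \x Q) A)%E.
Proof.
move=> c0 c'0 PP' A mA; rewrite !product_measure1_ysection//.
have mS (p : probability T R) := measurable_fun_ysection p mA.
rewrite -!ge0_integralZl//; do ?exact: mS.
apply: ge0_le_integral => //.
- by move=> x _; rewrite mule_ge0.
- by apply: emeasurable_funM => //; exact: mS.
- by apply: emeasurable_funM => //; exact: mS.
- by move=> y _; apply: PP'; exact: measurable_ysection.
Qed.

Lemma probability_diracE {d : measure_display} {T : measurableType d}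
    {R : realType} (x : T) (A : set T) :
  (\d_x : probability T R) A = (x \in A)%:R%:E.
Proof. exact: diracE. Qed.

Lemma probability_prodE {d d' : measure_display} {T : measurableType d}
    {T' : measurableType d'} {R : realType} (P : probability T R)
    (Q : probability T' R) (A : set T) (B : set T') :
  measurable A -> measurable B ->
  ((P \x Q)%E : probability (T * T')%type R) (A `*` B) = (P A * Q B)%E.
Proof. by move=> mA mB; exact: product_measure1E. Qed.

(** * Coordinate maps and boxes *)

Section Coordinates.
Context {R : realType} {n : nat} {X : 'I_n -> ptopologicalType}.
Implicit Types (a b : {set 'I_n}).

Lemma measurable_coordF i :
  measurable_fun setT (fun f : Xfull X => f i : Borel (X i)).
Proof.
by move=> _ B mB; rewrite setTI; apply: sub_sigma_algebra; exists i, B.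
Qed.

Lemma measurable_coord a (i : {i : 'I_n | i \in a}) :
  measurable_fun setT (fun f : Xs X a => f i : Borel (X (val i))).
Proof.
by move=> _ B mB; rewrite setTI; apply: sub_sigma_algebra; exists i, B.
Qed.

Lemma measurable_fun_Xfull {d : measure_display} {T : measurableType d}
    (f : T -> Xfull X) :
  (forall i, measurable_fun setT (fun t => f t i : Borel (X i))) ->
  measurable_fun setT f.
Proof.
move=> mf; apply: (@measurability _ _ _ (Xfull X) _ _ (cylF X : set (set (Xfull X)))) => //.
move=> _ [C [i [B mB ->]] <-].
exact: mf.
Qed.

Lemma measurable_fun_Xs {d : measure_display} {T : measurableType d} a
    (f : T -> Xs X a) :
  (forall i, measurable_fun setT (fun t => f t i : Borel (X (val i)))) ->
  measurable_fun setT f.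
Proof.
move=> mf; apply: (@measurability _ _ _ (Xs X a) _ _ (cylA X a : set (set (Xs X a)))) => //.
move=> _ [C [i [B mB ->]] <-].
exact: mf.
Qed.

Lemma measurable_Pr a : measurable_fun setT (Pr a : Xfull X -> Xs X a).
Proof. by apply: measurable_fun_Xs => i; exact: measurable_coordF. Qed.

Lemma measurable_restr a b (h : b \subset a) :
  measurable_fun setT (restr h : Xs X a -> Xs X b).
Proof.
apply: measurable_fun_Xs => i.
exact: (measurable_coord a (exist (fun j => j \in a) (val i) _)).
Qed.

Definition box (B : forall i, set (Borel (X i))) : set (Xfull X) :=
  [set f | forall i, B i (f i)].

Definition boxs a (B : forall i : {i : 'I_n | i \in a}, set (Borel (X (val i))))
  : set (Xs X a) := [set f | forall i, B i (f i)].

Lemma measurable_box B : (forall i, measurable (B i)) -> measurable (box B).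
Proof.
move=> mB.
rewrite (_ : box B = \bigcap_(i in [set: 'I_n]) [set f : Xfull X | B i (f i)]).
  apply: fin_bigcap_measurable => // i _.
  by rewrite -[X in measurable X]setTI; exact: measurable_coordF.
by apply/seteqP; split => f /= => [Bf i _|Bf i]; exact: Bf.
Qed.

Lemma measurable_boxs a B : (forall i, measurable (B i)) -> measurable (boxs a B).
Proof.
move=> mB.
rewrite (_ : boxs a B = \bigcap_(i in [set: {i : 'I_n | i \in a}])
    [set f : Xs X a | B i (f i)]).
  apply: fin_bigcap_measurable => // i _.
  by rewrite -[X in measurable X]setTI; exact: measurable_coord.
by apply/seteqP; split => f /= => [Bf i _|Bf i]; exact: Bf.
Qed.

(** Boxes with measurable sides form a pi-system that contains the whole space and generates the
    product sigma-algebra. *)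
Lemma eq_probability_box (P Q : probability (Xfull X) R) :
  (forall B, (forall i, measurable (B i)) -> P (box B) = Q (box B)) ->
  forall E, measurable E -> P E = Q E.
Proof.
move=> PQ.
pose G := [set box B | B in [set B : forall i, set (Borel (X i)) |
  forall i, measurable (B i)]].
apply: (measure_unique G (fun=> setT)) => //.
- apply/seteqP; split; last first.
    apply: smallest_sub; first exact: smallest_sigma_algebra.
    by move=> _ [B mB <-]; exact: measurable_box.
  apply: smallest_sub; first exact: smallest_sigma_algebra.
  move=> _ [i [B mB ->]]; apply: sub_sigma_algebra.
  (* A cylinder is the box whose sides other than [i] are full. *)
  exists (dfwith (fun=> setT) i B).
    by move=> j /=; case: dfwithP => // k ik.
  apply/seteqP; split => f /=.
    by move=> /(_ i); rewrite dfwithin.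
  by move=> Bf j; case: dfwithP.
- move=> _ _ [B mB <-] [C mC <-].
  exists (fun i => B i `&` C i).
    by move=> i; apply: measurableI; [exact: mB | exact: mC].
  apply/seteqP; split => f /=; first by move=> H; split=> i; have [] := H i.
  by move=> [Bf Cf] i.
- by move=> _; exists (fun=> setT); [move=> i; exact: measurableT | apply/seteqP; split].
- by rewrite bigcup_const.
- by move=> _ [B mB <-]; exact: PQ.
- by move=> _; apply: (le_lt_trans (probability_le1 P _)) => //; exact: ltry.
Qed.

(** * Existence of the finite product measure *)

Lemma prod_probability_exists (nu : forall i, probability (Borel (X i)) R) :
  exists Q : probability (Xfull X) R, forall B, (forall i, measurable (B i)) ->
    Q (box B) = (\prod_i fine (nu i (B i)))%:E.
Proof.
pose pt i : Borel (X i) := (point : X i).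
(* Interpolates between the Dirac mass at the base point ([s] empty) and the product of the [nu i]
   ([s] everything). *)
pose w (s : seq 'I_n) i : probability (Borel (X i)) R :=
  if i \in s then nu i else \d_(pt i).
suff /(_ (enum 'I_n)) [Q QE] : forall s : seq 'I_n,
    exists Q : probability (Xfull X) R, forall B, (forall i, measurable (B i)) ->
    Q (box B) = (\prod_i fine (w s i (B i)))%:E.
  exists Q => B mB; rewrite QE//; congr EFin; apply: eq_bigr => i _.
  by rewrite /w mem_enum.
(* Resample the coordinates one after the other, starting from a Dirac mass. *)
elim=> [|j s [Q QE]].
  exists (\d_(pt : Xfull X)) => B mB.
  rewrite probability_diracE; case: (pselect (box B pt)) => [BP|nBP].
    rewrite mem_set// big1// => i _; rewrite /w in_nil probability_diracE mem_set//.
  rewrite memNset//.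
  have [i nBi] : exists i, ~ B i (pt i).
    by apply/existsNP => H; apply: nBP => i; exact: H.
  by rewrite (bigD1 i)// /w in_nil probability_diracE memNset//= mul0r.
pose upd (p : Xfull X * Borel (X j)) : Xfull X := dfwith p.1 j p.2.
have mupd : measurable_fun setT upd.
  apply: measurable_fun_Xfull => i; have [<-|ij] := eqVneq j i.
    rewrite (_ : (fun _ => _) = snd); first exact: measurable_snd.
    by apply/funext => p; rewrite /upd dfwithin.
  rewrite (_ : (fun _ => _) = (fun f : Xfull X => f i : Borel (X i)) \o fst).
    by apply: measurableT_comp; [exact: measurable_coordF|exact: measurable_fst].
  by apply/funext => p; rewrite /upd dfwithout.
exists (pushP (Q \x nu j)%E mupd) => B mB; rewrite pushPE.
(* The old coordinate [j] is discarded, so its side is freed and contributes the factor 1. Hence it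
   does not matter whether [j] already occurs in [s]. *)
pose B' := dfwith B j setT.
have mB' i : measurable (B' i) by rewrite /B'; case: dfwithP.
rewrite (_ : _ @^-1` _ = box B' `*` B j); last first.
  apply/seteqP; split=> -[f x] /=.
    move=> H; split.
      move=> i; rewrite /B'; case: dfwithP => // k jk.
      by have := H k; rewrite /upd dfwithout.
    by have := H j; rewrite /upd dfwithin.
  move=> [Bf Bx] i; rewrite /upd/=.
  have [<-|ij] := eqVneq j i; first by rewrite dfwithin.
  by rewrite dfwithout//; have := Bf i; rewrite /B' dfwithout.
rewrite probability_prodE//; last exact: measurable_box.
rewrite QE// (bigD1 j)//= [in RHS](bigD1 j)//= /B' dfwithin probability_setT mul1r.
rewrite EFinM muleC /w inE eqxx/= fineK; last first.
  by apply: fin_num_measure; exact: mB.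
congr (_ * _)%E; congr EFin; apply: eq_bigr => i ij.
by rewrite dfwithout 1?eq_sym// inE (negPf ij).
Qed.

(** * Gluing a measure on the coordinates in [a] to a measure on the whole product *)

(** The second component is a full point whose coordinates in [a] get overwritten, which avoids a
    separate product over the complement. [pselect] supplies the membership proof that indexes
    [p.1]. *)
Definition glue a (p : Xs X a * Xfull X) : Xfull X := fun i =>
  match pselect (i \in a) with
  | left h => p.1 (exist (fun i => i \in a) i h)
  | right _ => p.2 i
  end.

Lemma glue_in a p (i : {i : 'I_n | i \in a}) : glue a p (val i) = p.1 i.
Proof.
case: i => i h /=; rewrite /glue; case: pselect => // h'.
by rewrite (bool_irrelevance h' h).
Qed.

Lemma glue_out a p i : i \notin a -> glue a p i = p.2 i.
Proof. by move=> /negP nia; rewrite /glue; case: pselect. Qed.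

Lemma measurable_glue a : measurable_fun setT (glue a).
Proof.
apply: measurable_fun_Xfull => i; case: (boolP (i \in a)) => [ia|nia].
  rewrite (_ : (fun _ => _) =
    (fun f : Xs X a => f (exist (fun i => i \in a) i ia) : Borel (X i)) \o fst).
    apply: measurableT_comp; last exact: measurable_fst.
    exact: (measurable_coord a (exist (fun i => i \in a) i ia)).
  by apply/funext => p /=; exact: (glue_in a p (exist (fun i => i \in a) i ia)).
rewrite (_ : (fun _ => _) = (fun f : Xfull X => f i : Borel (X i)) \o snd).
  by apply: measurableT_comp; [exact: measurable_coordF|exact: measurable_snd].
by apply/funext => p /=; rewrite glue_out.
Qed.

Lemma Pr_glue a p : Pr a (glue a p) = p.1.
Proof. by apply/functional_extensionality_dep => i; exact: glue_in. Qed.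

(** Seen from [b], gluing reads [p.1] only at coordinates common to [a] and [b]. *)
Lemma Pr_glue_setI a b (p : Xs X a * Xfull X) :
  Pr b (glue a p) = Pr b (glue (a :&: b) (restr (subsetIl a b) p.1, p.2)).
Proof.
apply/functional_extensionality_dep => -[i ib]; rewrite /Pr/=.
have [ia|nia] := boolP (i \in a).
  have iab : i \in a :&: b by rewrite inE ia.
  rewrite -[LHS]/(glue a p (val (exist (fun i => i \in a) i ia))).
  rewrite -[RHS]/(glue (a :&: b) (restr (subsetIl a b) p.1, p.2)
    (val (exist (fun i => i \in a :&: b) i iab))).
  rewrite !glue_in/= /restr /=; congr (p.1 (exist _ _ _)).
  exact: bool_irrelevance.
by rewrite !glue_out// inE negb_and nia.
Qed.

(** When [Q] is the product of the nu_i, this is the measure mu x nu_{a^c}. *)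
Definition glueP a (mu : probability (Xs X a) R) (Q : probability (Xfull X) R) :
  probability (Xfull X) R := pushP (mu \x Q)%E (measurable_glue a).

Lemma measurable_Pr_preimage a (E : set (Xs X a)) : measurable E ->
  measurable (Pr a @^-1` E : set (Xfull X)).
Proof. by move=> mE; rewrite -[X in measurable X]setTI; exact: measurable_Pr. Qed.

Lemma measurable_glue_preimage a (E : set (Xfull X)) : measurable E ->
  measurable (glue a @^-1` E).
Proof. by move=> mE; rewrite -[X in measurable X]setTI; exact: measurable_glue. Qed.

Lemma glueP_marginal a mu Q (E : set (Xs X a)) : measurable E ->
  glueP a mu Q (Pr a @^-1` E) = mu E.
Proof.
move=> mE; rewrite pushPE (_ : _ @^-1` _ = E `*` setT); last first.
  by apply/seteqP; split=> p /=; rewrite Pr_glue => // -[].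
by rewrite probability_prodE// probability_setT mule1.
Qed.

(** For a fixed second component [y], the section of a [b]-event is pulled back from the coordinates
    in [a :&: b], where both measures agree; it remains to integrate over [y]. *)
Lemma glueP_marginal_setI a b (mu mu' : probability (Xs X a) R) Q :
  (forall F, measurable F -> mu (restr (subsetIl a b) @^-1` F) =
                             mu' (restr (subsetIl a b) @^-1` F)) ->
  forall E, measurable E ->
    glueP a mu Q (Pr b @^-1` E) = glueP a mu' Q (Pr b @^-1` E).
Proof.
move=> mumu' E mE; rewrite !pushPE.
have mG := measurable_glue_preimage a _ (measurable_Pr_preimage b E mE).
rewrite [LHS]product_measure1_ysection// [RHS]product_measure1_ysection//.
apply: eq_integral => y _.
have mF := measurable_glue_preimage (a :&: b) _ (measurable_Pr_preimage b E mE).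
rewrite (_ : ysection _ y = restr (subsetIl a b) @^-1`
    ysection (glue (a :&: b) @^-1` (Pr b @^-1` E)) y).
  by apply: mumu'; exact: measurable_ysection.
by rewrite !ysectionE; apply/seteqP; split=> x /=; rewrite (Pr_glue_setI a b (x, y)).
Qed.

Lemma le_glueP a (mu mu' : probability (Xs X a) R) Q (c c' : R) : 0 <= c -> 0 <= c' ->
  (forall E, measurable E -> (c%:E * mu E <= c'%:E * mu' E)%E) ->
  forall E, measurable E -> (c%:E * glueP a mu Q E <= c'%:E * glueP a mu' Q E)%E.
Proof.
move=> c0 c'0 le_mu E mE.
by apply: le_product_measure1 => //; exact: measurable_glue_preimage.
Qed.

(** * Gluing and marginals for the product measure *)

Section ProductMeasure.
Variables (nu : forall i, probability (Borel (X i)) R).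
Variable (Q : probability (Xfull X) R).
Hypothesis QE : forall B, (forall i, measurable (B i)) ->
  Q (box B) = (\prod_i fine (nu i (B i)))%:E.

Lemma glueP_product a nua : is_product_measure a nu nua ->
  forall E, measurable E -> glueP a nua Q E = Q E.
Proof.
move=> nuaE; apply: eq_probability_box => B mB; rewrite QE// pushPE.
(* The sides in [a] constrain the first component only, so they are freed for the second. *)
pose C i : set (Borel (X i)) := if i \in a then setT else B i.
have mC i : measurable (C i) by rewrite /C; case: ifP.
rewrite (_ : _ @^-1` _ = boxs a (fun i => B (val i)) `*` box C); last first.
  apply/seteqP; split=> -[x y] /=.
    move=> H; split=> [i|i]; first by have := H (val i); rewrite glue_in.
    by rewrite /C; case: ifPn => // nia; have := H i; rewrite glue_out.
  move=> [Bx Cy] i; have [ia|nia] := boolP (i \in a).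
    by have := glue_in a (x, y) (exist (fun i => i \in a) i ia) => /= ->;
      exact: (Bx (exist (fun i => i \in a) i ia)).
  by rewrite glue_out//; have := Cy i; rewrite /C (negPf nia).
rewrite probability_prodE; [|by apply: measurable_boxs|exact: measurable_box].
rewrite nuaE// QE// -EFinM; congr EFin.
rewrite [RHS](bigID (fun i => i \in a))/=; congr (_ * _).
  by rewrite (big_sub (fun i => i \in a) (fun i => fine (nu i (B i)))).
rewrite (bigID (fun i => i \in a))/= big1 ?mul1r.
  by apply: eq_bigr => i nia; rewrite /C (negPf nia).
by move=> i ia; rewrite /C ia probability_setT.
Qed.

(** Together with [glueP_product] this shows that gluing the [a]-marginal of [Q] back to [Q] returns
    [Q]. *)
Lemma Pr_product a : is_product_measure a nu (pushP Q (measurable_Pr a)).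
Proof.
move=> B mB; rewrite pushPE.
pose C i : set (Borel (X i)) :=
  match pselect (i \in a) with
  | left h => B (exist (fun i => i \in a) i h) | right _ => setT end.
have C_in (i : {i : 'I_n | i \in a}) : C (val i) = B i.
  case: i => i h; rewrite /C/=; case: pselect => // h'.
  by rewrite (bool_irrelevance h' h).
have C_out i : i \notin a -> C i = setT.
  by move=> /negP nia; rewrite /C; case: pselect.
have mC i : measurable (C i).
  rewrite /C; case: pselect => [h|_]; last exact: measurableT.
  exact: (mB (exist (fun i => i \in a) i h)).
rewrite (_ : _ @^-1` _ = box C); last first.
  apply/seteqP; split=> f /=.
    move=> H i; have [ia|nia] := boolP (i \in a); last by rewrite C_out.
    have := H (exist (fun i => i \in a) i ia).
    by rewrite -(C_in (exist (fun i => i \in a) i ia)).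
  by move=> H i; rewrite -C_in; exact: (H (val i)).
rewrite QE//; congr EFin; rewrite [LHS](bigID (fun i => i \in a))/= [X in _ * X]big1.
  rewrite mulr1 (big_sub (fun i => i \in a) (fun i => fine (nu i (C i)))).
  by apply: eq_bigr => i _; rewrite C_in.
by move=> i nia; rewrite C_out// probability_setT.
Qed.

End ProductMeasure.

End Coordinates.

(** * From bounds on densities to bounds on measures *)

Lemma has_density_bounds {d : measure_display} {T : measurableType d}
    {R : realType} (mu nu : probability T R) (rho : T -> R) (m M : R) :
  0 <= m -> m <= M -> has_density mu nu rho ->
  {ae nu, forall x, m <= rho x <= M} ->
  forall E, measurable E -> (m%:E * nu E <= mu E <= M%:E * nu E)%E.
Proof.
move=> m0 mM [mrho muE] rhomM E mE.
(* [rho] may be negative on a null set, so truncate it. *)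
pose r x := Num.max m (Num.min M (rho x)).
have mr : measurable_fun setT r.
  by apply: measurable_maxr => //; apply: measurable_minr.
have mrE : measurable_fun E (EFin \o r).
  by apply/measurable_EFinP; exact: measurable_funTS.
have r_bounds x : m <= r x <= M.
  by rewrite /r le_max lexx/= ge_max mM ge_min lexx.
have -> : mu E = (\int[nu]_(x in E) (r x)%:E)%E.
  rewrite muE//; apply: ae_eq_integral => //.
  - by apply/measurable_EFinP; exact: measurable_funTS.
  - apply: filterS rhomM => x /andP[mx xM] _.
    by rewrite /r (min_idPr xM) (max_idPr mx).
rewrite -!integral_cst//; apply/andP; split; apply: ge0_le_integral => //.
- by move=> x _; rewrite lee_fin; case/andP: (r_bounds x).
- by move=> x _; rewrite lee_fin (le_trans m0)//; case/andP: (r_bounds x).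
- by move=> x _; rewrite lee_fin; case/andP: (r_bounds x).
Qed.

(** Both total masses are 1, which forces m <= 1 <= M. Then M <= (1 + eps) m gives M <= 1 + eps and
    m >= 1 / (1 + eps) >= 1 - eps. *)
Lemma has_density_ratio_bounds {d : measure_display} {T : measurableType d}
    {R : realType} (mu nu : probability T R) (rho : T -> R) (m M eps : R) :
  0 <= eps <= 1 ->
  0 < m -> m <= M -> M / m <= 1 + eps -> has_density mu nu rho ->
  {ae nu, forall x, m <= rho x <= M} ->
  forall E, measurable E ->
    ((1 - eps)%:E * nu E <= mu E <= (1 + eps)%:E * nu E)%E.
Proof.
move=> /andP[eps0 eps1] m0 mM Mm murho rhomM E mE.
have bnd := has_density_bounds mu nu rho m M (ltW m0) mM murho rhomM.
have := bnd setT measurableT.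
rewrite !probability_setT !mule1 !lee_fin => /andP[m1 M1].
have {Mm}Mm : M <= (1 + eps) * m by rewrite -ler_pdivrMr.
have /andP[lo hi] := bnd E mE.
apply/andP; split.
  apply: le_trans lo; apply: lee_wpmul2r => //; rewrite lee_fin; nra.
apply: (le_trans hi); apply: lee_wpmul2r => //; rewrite lee_fin; nra.
Qed.

(** The three deviations from [q] add up: [e] from [p], [d] from [g] and [e] from [k]. *)
Lemma correction_bounds {R : realFieldType} (p g k q e d : R) : 0 <= q ->
  (1 - e) * q <= p <= (1 + e) * q -> (1 - d) * q <= g <= (1 + d) * q ->
  (1 - e) * q <= k <= (1 + e) * q ->
  (1 - (2 * e + d)) * q <= p + g - k <= (1 + (2 * e + d)) * q.
Proof.
move=> q0 /andP[p1 p2] /andP[g1 g2] /andP[k1 k2].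
by apply/andP; split; lra.
Qed.

(** * Successive correction of the marginals *)

Section Correction.
Context {R : realType} {n : nat} {X : 'I_n -> ptopologicalType}.
Variables (k : nat) (mu nuA : forall a : {set 'I_n}, probability (Xs X a) R).
Variables (nu : forall i, probability (Borel (X i)) R) (eps : R).
Variable (Q : probability (Xfull X) R).
Hypothesis mu_consistent : consistent k mu.
Hypothesis nuAE : forall a : {set 'I_n}, #|a| = k -> is_product_measure a nu (nuA a).
Hypothesis eps0 : 0 <= eps.
Hypothesis mu_bounds : forall a : {set 'I_n}, #|a| = k -> forall E, measurable E ->
  ((1 - eps)%:E * nuA a E <= mu a E <= (1 + eps)%:E * nuA a E)%E.
Hypothesis QE : forall B, (forall i, measurable (B i)) ->
  Q (box B) = (\prod_i fine (nu i (B i)))%:E.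

(** The marginal of [P] on [a :&: b] can be read off through [b], where it comes from [mu b];
    consistency then replaces [mu b] by [mu a]. *)
Lemma marginal_setI (P : probability (Xfull X) R) (a b : {set 'I_n}) :
  #|a| = k -> #|b| = k ->
  (forall E, measurable E -> P (Pr b @^-1` E) = mu b E) ->
  forall F : set (Xs X (a :&: b)), measurable F ->
    pushP P (measurable_Pr a) (restr (subsetIl a b) @^-1` F) =
    mu a (restr (subsetIl a b) @^-1` F).
Proof.
move=> ak bk PE F mF; rewrite (mu_consistent a b)// -PE//.
by rewrite -[X in measurable X]setTI; exact: measurable_restr.
Qed.

(** The bound against [Q] is carried through the induction because it makes the next corrected
    measure nonnegative. The head of the list is treated last, and the recursion e = 2 e' + eps
    starting from 0 has the solution (2^N - 1) eps. *)
Lemma correction (s : seq {set 'I_n}) (e : R) :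
  e = (2 ^+ size s - 1) * eps -> e <= 1 -> {in s, forall a : {set 'I_n}, #|a| = k} ->
  exists P : probability (Xfull X) R,
    (forall E, measurable E -> ((1 - e)%:E * Q E <= P E <= (1 + e)%:E * Q E)%E) /\
    {in s, forall a, forall E, measurable E -> P (Pr a @^-1` E) = mu a E}.
Proof.
have eps_ge0 := eps0.
elim: s e => [|a s IH] e /=.
  rewrite expr0 subrr mul0r => -> _ _; exists Q; split=> // E mE.
  by rewrite subr0 addr0 mul1e lexx.
move=> eE e1 sk; have [e' e'E] : exists e' : R, e' = (2 ^+ size s - 1) * eps.
  by eexists.
have ee' : e = 2 * e' + eps by rewrite eE e'E exprS; ring.
have e'0 : 0 <= e'.
  by rewrite e'E mulr_ge0// subr_ge0; apply: exprn_ege1; rewrite ler1n.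
have [||P [PQ Pmu]] := IH e' e'E; first by lra.
  by move=> b bs; apply: sk; rewrite inE bs orbT.
have ak : #|a| = k by apply: sk; rewrite inE eqxx.
(* [K] is the term to subtract, Pr_a P x nu_{a^c}, and [G] the term to add, mu_a x nu_{a^c}. *)
pose K := glueP a (pushP P (measurable_Pr a)) Q.
pose G := glueP a (mu a) Q.
(* [Q] is written as a glued measure in two ways, so that monotonicity of gluing compares [K] and
   [G] with it. *)
have ak_QE : forall E, measurable E ->
    glueP a (pushP Q (measurable_Pr a)) Q E = Q E.
  exact: (glueP_product nu Q QE a _ (Pr_product nu Q QE a)).
have ak_nuAE : forall E, measurable E -> glueP a (nuA a) Q E = Q E.
  exact: (glueP_product nu Q QE a _ (nuAE a ak)).
have eps1 : 0 <= 1 - eps.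
  by rewrite subr_ge0 (le_trans _ e1)// ee' lerDr mulr_ge0.
have e'1 : 0 <= 1 - e'.
  by rewrite subr_ge0 (le_trans _ e1)// ee' mulr_natl mulr2n -addrA lerDl addr_ge0.
have [e'D1 epsD1] : 0 <= 1 + e' /\ 0 <= 1 + eps by split; rewrite addr_ge0.
have KE E : measurable E -> ((1 - e')%:E * Q E <= K E <= (1 + e')%:E * Q E)%E.
  move=> mE; rewrite -(ak_QE E mE) -[K E]mul1e.
  apply/andP; split; apply: le_glueP => // F mF;
    by rewrite mul1e; have /andP[] := PQ _ (measurable_Pr_preimage a F mF).
have GE E : measurable E -> ((1 - eps)%:E * Q E <= G E <= (1 + eps)%:E * Q E)%E.
  move=> mE; rewrite -(ak_nuAE E mE) -[G E]mul1e.
  apply/andP; split; apply: le_glueP => // F mF;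
    by rewrite mul1e; have /andP[] := mu_bounds a ak F mF.
(* All values are finite, which moves the estimate from extended reals to real arithmetic. *)
have fin (P' : probability (Xfull X) R) E : measurable E ->
  P' E = (fine (P' E))%:E by move=> mE; rewrite fineK// fin_num_measure.
have PGK E : measurable E ->
    (1 - e) * fine (Q E) <= fine (P E) + fine (G E) - fine (K E)
      <= (1 + e) * fine (Q E).
  move=> mE; have := PQ E mE; have := KE E mE; have := GE E mE.
  rewrite (fin P)// (fin G)// (fin K)// (fin Q)// -!EFinM !lee_fin /= => GE' KE' PE'.
  by rewrite ee'; apply: correction_bounds => //; rewrite fine_ge0.
(* Positivity: P + G - K >= (1 - e) Q >= 0, since e <= 1. *)
have [|P' P'E] := probability_addsub P G K.
  move=> E mE; rewrite (fin P)// (fin G)// (fin K)// -EFinD lee_fin -subr_ge0.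
  have /andP[+ _] := PGK E mE; apply: le_trans.
  by rewrite mulr_ge0 ?fine_ge0// subr_ge0.
exists P'; split.
  move=> E mE; have := PGK E mE.
  by rewrite P'E// (fin P)// (fin G)// (fin K)// (fin Q)//
    -EFinN -!EFinD -!EFinM !lee_fin.
(* On [a] the marginals of [P] and [K] cancel and [mu a] remains. *)
move=> b; rewrite inE => /orP[/eqP ->|bs] E mE.
  have mPrE := measurable_Pr_preimage a E mE.
  rewrite P'E// !glueP_marginal// (pushPE P _ (measurable_Pr a)).
  by rewrite (addeC (P _)) addeK// fin_num_measure.
(* On a set [b] treated earlier, [K] and [G] have the same marginal, so that of [P] survives. *)
have mPrE := measurable_Pr_preimage b E mE.
rewrite P'E// (_ : K _ = G (Pr b @^-1` E)); last first.
  apply: glueP_marginal_setI => // F mF; apply: (marginal_setI _ _ b) => //.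
  - by apply: sk; rewrite inE bs orbT.
  - exact: Pmu.
by rewrite addeK ?fin_num_measure// Pmu.
Qed.

End Correction.
Theorem mainTheorem2 (R : realType) (n k : nat) :
  (1 <= k)%N -> (k < n)%N ->
  exists lam : R, 1 < lam /\
  forall (X : 'I_n -> ptopologicalType)
    (mu : forall A : {set 'I_n}, probability (Xs X A) R)
    (nu : forall i : 'I_n, probability (Borel (X i)) R)
    (nuA : forall A : {set 'I_n}, probability (Xs X A) R)
    (rho : forall A : {set 'I_n}, Xs X A -> R)
    (m M : R),
    (forall i, polish R (X i)) ->
    consistent k mu ->
    (forall a : {set 'I_n}, #|a| = k -> is_product_measure a nu (nuA a)) ->
    (forall a : {set 'I_n}, #|a| = k -> has_density (mu a) (nuA a) (rho a)) ->
    0 < m -> m <= M ->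
    (forall a : {set 'I_n}, #|a| = k ->
       {ae nuA a, forall x, m <= rho a x <= M}) ->
    M / m <= lam ->
    exists P : probability (Xfull X) R, uniting k mu P.
Proof.
move=> _ _.
pose s := [seq a : {set 'I_n} <- enum {: {set 'I_n}} | #|a| == k].
(* With N = [size s], the final deviation is (2^N - 1) eps = 1 - 2^-N, below 1. The choice is made
   before the spaces and measures are given. *)
pose eps : R := (2 ^+ size s)^-1.
have eps_gt0 : 0 < eps by rewrite invr_gt0 exprn_gt0.
have eps_le1 : eps <= 1 by rewrite invf_le1 ?exprn_gt0// exprn_ege1// ler1n.
exists (1 + eps); split; first by rewrite ltrDl.
move=> X mu nu nuA rho m M _ mu_cons nuAE murho m0 mM rhomM Mm.
have [Q QE] := prod_probability_exists nu.
have mu_bounds (a : {set 'I_n}) : #|a| = k -> forall E, measurable E ->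
    ((1 - eps)%:E * nuA a E <= mu a E <= (1 + eps)%:E * nuA a E)%E.
  move=> ak; apply: (has_density_ratio_bounds _ _ (rho a) m M) => //.
  - by rewrite ltW.
  - exact: murho.
  - exact: rhomM.
have [|a|P [_ Pmu]] := correction k mu nuA nu eps Q mu_cons nuAE (ltW eps_gt0)
    mu_bounds QE s _ erefl.
- by rewrite mulrBl mul1r divff ?expf_neq0// gerBl ltW.
- by rewrite mem_filter => /andP[/eqP].
by exists P => a ak; apply: Pmu; rewrite mem_filter ak eqxx mem_enum.
Qed.
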